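(* Let $n,K,M,s,f$ be integers with $n=KM$, $K \ge 1$, $1\le s\le M$ and $0\le f\le n-2$, and consider the parallel mixnet process on $n$ cards with $M$ servers, each handling $K$ cards per round, with $M-s$ corrupted servers and $f$ adversarially generated (marked) inputs, and with potential $\Phi(t)$ after $t$ rounds. Let $\gamma=\mathbf{E}[\Delta\Phi/\Phi]$ be the expected relative decrease of the potential in one round in that setting. Let $b\ge 1$ be fixed. If $0<\gamma<1$, then after $t=\lceil b\log_{1/(1-\gamma)} n\rceil$ rounds the expected sum-of-squares error between the card-assignment probabilities and the uniform distribution satisfies $\mathbf{E}[\Phi(t)]\le 1/n^b$. In particular: if $\gamma\ge 1/2$, then $\mathbf{E}[\Phi(t)]\le 1/n^b$ already holds for $t=\lceil b\log_2 n\rceil$ rounds; and if $\gamma\ge 1-n^{-1/c}$ for a constant $c\ge 1$, then $\mathbf{E}[\Phi(t)]\le 1/n^b$ already holds for $t=\lceil bc\rceil$ rounds.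
   Context: Parallel mixnet with corrupted servers and adversarially generated inputs: there are $n$ cards (messages) and $M=n/K$ servers, of which a fixed set of $s$ servers is non-corrupted and the other $M-s$ are corrupted; $f$ of the $n$ cards are marked (fake messages injected by the adversary). In each round, (1) the cards are placed in order according to a uniformly random permutation, independent of all previous randomness, which the adversary sees; (2) under this ordering the cards are divided into $M$ consecutive groups of $K$ cards, one group per server; (3) each server permutes its $K$ cards uniformly at random; the permutation is hidden from the adversary if the server is non-corrupted and revealed to the adversary if it is corrupted (so it may be treated as the identity). The adversary knows the initial ordering and always sees the locations of the marked cards. A particular unmarked card is tracked. For $i=1,\dots,n-f$, $w_i(t)$ is the probability, from the point of view of the adversary, that the $i$-th unmarked card after $t$ rounds is the tracked card. Concretely, $w(0)=(1,0,\dots,0)\in\mathbb{R}^{n-f}$, and in each round: the $n$ cards (the $n-f$ unmarked ones carrying the weights $w_1(t),\dots,w_{n-f}(t)$ and the $f$ marked ones carrying no weight) are assigned to the $n$ positions by a fresh uniformly random permutation; the positions are split into $M$ consecutive blocks of size $K$, one per server; in each block belonging to a non-corrupted server, the weights of the $K'\le K$ unmarked cards in that block are all replaced by their average; weights in blocks of corrupted servers are unchanged. The resulting weights are $w(t+1)$. The potential (sum-of-squares error relative to the uniform distribution on the $n-f$ unmarked cards) is $$\Phi(t)=\left(\sum_{i=1}^{n-f} w_i(t)^2\right)-\frac{1}{n-f}=\sum_{i=1}^{n-f}\left(w_i(t)-\frac1{n-f}\right)^2,$$ a random variable depending on the visible randomness, and $\mathbf{E}$ denotes expectation over that randomness. The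 cases $s=M$ (no corrupted servers) or $f=0$ (no marked inputs) are allowed. One writes $\Delta\Phi(t)=\Phi(t)-\Phi(t+1)$. The quantity $\gamma=\mathbf{E}[\Delta\Phi/\Phi]$ means the expectation of $\Delta\Phi(t)/\Phi(t)$ over the randomness of a single round, given the current weight vector $w(t)$ with $\Phi(t)>0$; in this setting its value does not depend on $t$ or on $w(t)$, only on $n,K,s,f$. *)

(* Defs.v *)
From HB Require Import structures.
From mathcomp Require Import all_boot all_order all_algebra all_fingroup.
From mathcomp Require Import reals exp.

Set Implicit Arguments.
Unset Strict Implicit.
Unset Printing Implicit Defensive.

Import Order.TTheory GRing.Theory Num.Theory.
Local Open Scope ring_scope.

Definition expect_unif (R : realType) (T : finType) (X : T -> R) : R :=
  (\sum_(x : T) X x) / #|T|%:R.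

(* The base is a. *)
Definition log (R : realType) (a x : R) : R := ln x / ln a.

(* Ceiling as a natural number; only meant for x >= 0 (it is the absolute
   value of the integer ceiling). *)
Definition ceiln (R : realType) (x : R) : nat := `|Num.ceil x|%N.

(* Cards are 'I_n: the first n - f are the unmarked ones, the last f the marked
   ones. p sends each card to the position it is placed at; this is the
   position of the i-th unmarked card. *)
Definition upos (n f : nat) (p : {perm 'I_n}) (i : 'I_(n - f)) : 'I_n :=
  p (widen_ord (leq_subr f n) i).

(* Position q belongs to server q %/ K: consecutive blocks of K positions. *)
Definition server (n K : nat) (q : 'I_n) : nat := (q %/ K)%N.

Definition group_mates (n f K : nat) (p : {perm 'I_n}) (i : 'I_(n - f)) :
    {set 'I_(n - f)} :=
  [set j | server K (upos p j) == server K (upos p i)].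

(* H is the set of non-corrupted servers. *)
Definition handled_honestly (n f K M : nat) (H : {set 'I_M})
    (p : {perm 'I_n}) (i : 'I_(n - f)) : bool :=
  [exists j in H, server K (upos p i) == j :> nat].

(* One round, as seen by the adversary. The permutation applied by a server of
   H is hidden, whence the average (over the unmarked cards of its group only,
   since the marked ones stay visible); that of a server outside H is revealed,
   so it is taken to be the identity. *)
Definition mix_round (R : realType) (n f K M : nat) (H : {set 'I_M})
    (w : 'rV[R]_(n - f)) (p : {perm 'I_n}) : 'rV[R]_(n - f) :=
  \row_i (if handled_honestly K H p i
          then (\sum_(j in group_mates K p i) w 0 j) / #|group_mates K p i|%:R
          else w 0 i).

Definition init_weights (R : realType) (m : nat) : 'rV[R]_m :=
  \row_i ((i == 0%N :> nat)%:R).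

(* w(t), as a function of the t public permutations, listed in the order of
   the rounds. *)
Definition weights (R : realType) (n f K M : nat) (H : {set 'I_M}) (t : nat)
    (rho : t.-tuple {perm 'I_n}) : 'rV[R]_(n - f) :=
  foldl (mix_round K H) (init_weights R (n - f)) rho.

Definition Phi (R : realType) (m : nat) (w : 'rV[R]_m) : R :=
  (\sum_i w 0 i ^+ 2) - m%:R^-1.

(* E[Phi(t)]; t independent uniform permutations are a uniform t-tuple. *)
Definition expected_Phi (R : realType) (n f K M : nat) (H : {set 'I_M})
    (t : nat) : R :=
  expect_unif (fun rho : t.-tuple {perm 'I_n} => Phi (weights R f K H rho)).

(* E[(Phi(t) - Phi(t+1)) / Phi(t)] over a single round, given w(t) = w. *)
Definition rel_decrease (R : realType) (n f K M : nat) (H : {set 'I_M})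
    (w : 'rV[R]_(n - f)) : R :=
  expect_unif (fun p : {perm 'I_n} => (Phi w - Phi (mix_round K H w p)) / Phi w).

(* Main.v *)
(** One round is a linear map of the weights whose matrix depends only on the
    public permutation, so the expected sum of squares after a round is a
    quadratic form in w. Exchanging two unmarked cards preserves the uniform
    distribution on permutations, so all diagonal coefficients of this form are
    equal, and so are all its off-diagonal ones. As the uniform weights are fixed
    by every round, it follows that E[Phi] is multiplied by the same constant
    lambda = 1 - gamma for every weight vector of total weight 1, and
    E[Phi(t)] = (1 - gamma)^t Phi(0). *)
Require Import Defs.
From HB Require Import structures.
From mathcomp Require Import all_boot all_order all_algebra all_fingroup.
From mathcomp Require Import reals exp.
From mathcomp Require Import ring lra.

Set Implicit Arguments.
Unset Strict Implicit.
Unset Printing Implicit Defensive.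

Import Order.TTheory GRing.Theory Num.Theory.
Local Open Scope ring_scope.

(** * The matrix of one round: symmetric, with unit row sums *)

Definition round_coef (R : realType) (n f K M : nat) (H : {set 'I_M})
    (p : {perm 'I_n}) (i j : 'I_(n - f)) : R :=
  if handled_honestly K H p i
  then (j \in group_mates K p i)%:R / #|group_mates K p i|%:R
  else (i == j)%:R.

Lemma mix_roundE (R : realType) (n f K M : nat) (H : {set 'I_M})
    (w : 'rV[R]_(n - f)) (p : {perm 'I_n}) (i : 'I_(n - f)) :
  mix_round K H w p 0 i = \sum_j round_coef R K H p i j * w 0 j.
Proof.
rewrite mxE /round_coef; case: ifP => _.
  rewrite big_mkcond mulr_suml; apply: eq_bigr => j _.
  by case: (j \in _); rewrite ?mul0r // mul1r mulrC.
rewrite (bigD1 i) //= eqxx mul1r big1 ?addr0 // => j.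
by rewrite eq_sym => /negbTE ->; rewrite mul0r.
Qed.

Lemma card_group_mates_gt0 (n f K : nat) (p : {perm 'I_n}) (i : 'I_(n - f)) :
  (0 < #|group_mates K p i|)%N.
Proof. by apply/card_gt0P; exists i; rewrite inE. Qed.

Lemma round_coef_row_sum (R : realType) (n f K M : nat) (H : {set 'I_M})
    (p : {perm 'I_n}) (i : 'I_(n - f)) :
  \sum_j round_coef R K H p i j = 1.
Proof.
rewrite /round_coef; case: (handled_honestly K H p i); last first.
  rewrite (bigD1 i) //= eqxx big1 ?addr0 // => j.
  by rewrite eq_sym => /negbTE ->.
have -> : \sum_j (j \in group_mates K p i)%:R / #|group_mates K p i|%:R =
          #|group_mates K p i|%:R / #|group_mates K p i|%:R :> R.
  rewrite -mulr_suml; congr (_ / _); rewrite -sum1_card natr_sum [RHS]big_mkcond.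
  by apply: eq_bigr => j _; case: (j \in _).
by rewrite divff // pnatr_eq0 -lt0n card_group_mates_gt0.
Qed.

(** Cards in the same group have the same server and the same mates; for cards in different groups
    both coefficients vanish. *)
Lemma round_coef_sym (R : realType) (n f K M : nat) (H : {set 'I_M})
    (p : {perm 'I_n}) (i j : 'I_(n - f)) :
  round_coef R K H p i j = round_coef R K H p j i.
Proof.
case: (eqVneq (server K (upos p i)) (server K (upos p j))) => [e|ne].
  have em : group_mates K p i = group_mates K p j.
    by apply/setP => k; rewrite !inE e.
  rewrite /round_coef /handled_honestly e em (eq_sym i j).
  by rewrite -{1}em !inE e eqxx.
have nij : i != j by apply: contraNneq ne => ->.
rewrite /round_coef !inE (eq_sym (server K (upos p j))) (negbTE ne).
by rewrite (eq_sym j i) (negbTE nij) !mul0r !if_same.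
Qed.

(** By symmetry the column sums equal the row sums, hence are 1. *)
Lemma mix_round_sum (R : realType) (n f K M : nat) (H : {set 'I_M})
    (w : 'rV[R]_(n - f)) (p : {perm 'I_n}) :
  \sum_i mix_round K H w p 0 i = \sum_i w 0 i.
Proof.
under eq_bigr do rewrite mix_roundE.
rewrite exchange_big; apply: eq_bigr => j _ /=.
rewrite -mulr_suml; under eq_bigr do rewrite round_coef_sym.
by rewrite round_coef_row_sum mul1r.
Qed.

(** * Invariance under exchanging two unmarked cards *)

Definition swap_cards (n f : nat) (a b : 'I_(n - f)) : {perm 'I_n} :=
  tperm (widen_ord (leq_subr f n) a) (widen_ord (leq_subr f n) b).

Lemma upos_swap (n f : nat) (a b : 'I_(n - f)) (p : {perm 'I_n})
    (i : 'I_(n - f)) :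
  upos (swap_cards a b * p) i = upos p (tperm a b i).
Proof.
(* The inclusion of the unmarked cards among all cards is injective, so it carries one transposition
   to the other. *)
have winj : injective (widen_ord (leq_subr f n)).
  by move=> x y /(congr1 val) /= /val_inj.
by rewrite /upos permM /swap_cards -(inj_tperm a b i winj).
Qed.

(** Composing with the swap relabels cards before they are placed: groups are replaced by their
    preimages, of the same size, and servers depend on positions only. *)
Lemma round_coef_swap (R : realType) (n f K M : nat) (H : {set 'I_M})
    (a b : 'I_(n - f)) (p : {perm 'I_n}) (i j : 'I_(n - f)) :
  round_coef R K H (swap_cards a b * p) i j =
  round_coef R K H p (tperm a b i) (tperm a b j).
Proof.
have em : group_mates K (swap_cards a b * p) i =
          tperm a b @^-1: group_mates K p (tperm a b i).
  by apply/setP => k; rewrite !inE !upos_swap.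
have ec : #|group_mates K (swap_cards a b * p) i| =
          #|group_mates K p (tperm a b i)|.
  rewrite em on_card_preimset //; apply/onW_bij.
  by exists (tperm a b) => x; rewrite tpermK.
rewrite /round_coef ec em /handled_honestly upos_swap !inE.
by rewrite (inj_eq (@perm_inj _ _)).
Qed.

(** With $A_p$ the matrix of the round, this is the entry $(j,k)$ of $\mathbf{E}[A_p^T A_p]$. *)
Definition round_gram (R : realType) (n f K M : nat) (H : {set 'I_M})
    (j k : 'I_(n - f)) : R :=
  expect_unif (fun p : {perm 'I_n} =>
    \sum_i round_coef R K H p i j * round_coef R K H p i k).

(** Left multiplication by the swap is a bijection of the permutations, so it preserves the uniform
    average. *)
Lemma round_gram_swap (R : realType) (n f K M : nat) (H : {set 'I_M})
    (a b j k : 'I_(n - f)) :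
  round_gram R K H (tperm a b j) (tperm a b k) = round_gram R K H j k.
Proof.
rewrite /round_gram /expect_unif; congr (_ / _).
rewrite [RHS](reindex_inj (mulgI (swap_cards a b))) /=.
apply: eq_bigr => p _.
rewrite (reindex_inj (@perm_inj _ (tperm a b))).
by apply: eq_bigr => i _; rewrite !round_coef_swap.
Qed.

Lemma round_gram_diag (R : realType) (n f K M : nat) (H : {set 'I_M})
    (j j' : 'I_(n - f)) :
  round_gram R K H j j = round_gram R K H j' j'.
Proof. by rewrite -(round_gram_swap R K H j j') tpermL. Qed.

Lemma round_gram_offdiag (R : realType) (n f K M : nat) (H : {set 'I_M})
    (j k j' k' : 'I_(n - f)) :
  j != k -> j' != k' -> round_gram R K H j k = round_gram R K H j' k'.
Proof.
move=> njk njk'; rewrite -(round_gram_swap R K H j j') tpermL.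
(* The first exchange sends [j] to [j'] and [k] to [k1]; a second one sends [k1] to [k'] and fixes
   [j'], which differs from both. *)
set k1 := tperm j j' k.
have nk1 : k1 != j' by rewrite -[X in _ != X](tpermL j j') (inj_eq perm_inj) eq_sym.
by rewrite -(round_gram_swap R K H k1 k') tpermL tpermD // eq_sym.
Qed.

(** * The expected potential after one round *)

Lemma expect_unif_sqsum (R : realType) (n f K M : nat) (H : {set 'I_M})
    (w : 'rV[R]_(n - f)) :
  expect_unif (fun p : {perm 'I_n} => \sum_i mix_round K H w p 0 i ^+ 2) =
  \sum_j \sum_k round_gram R K H j k * (w 0 j * w 0 k).
Proof.
rewrite /round_gram /expect_unif.
(* The common denominator leaves the double sum; then the sums over [p] and [i] are moved
   outermost. *)
under [RHS]eq_bigr do under eq_bigr do rewrite mulrAC.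
under [RHS]eq_bigr do rewrite -mulr_suml.
rewrite -mulr_suml; congr (_ / _).
under [RHS]eq_bigr do under eq_bigr do rewrite mulr_suml.
under [RHS]eq_bigr do rewrite exchange_big /=.
rewrite [RHS]exchange_big /=; apply: eq_bigr => p _.
under [RHS]eq_bigr do under eq_bigr do rewrite mulr_suml.
under [RHS]eq_bigr do rewrite exchange_big /=.
rewrite [RHS]exchange_big /=; apply: eq_bigr => i _.
rewrite mix_roundE expr2 mulr_suml; apply: eq_bigr => j _.
by rewrite mulr_sumr; apply: eq_bigr => k _; ring.
Qed.

Lemma expect_unif_const (R : realType) (T : finType) (c : R) :
  (0 < #|T|)%N -> expect_unif (fun _ : T => c) = c.
Proof.
by move=> T0; rewrite /expect_unif sumr_const -[c *+ _]mulr_natr mulfK // pnatr_eq0 -lt0n.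
Qed.

Lemma expect_unifB (R : realType) (T : finType) (X Y : T -> R) :
  expect_unif (fun x => X x - Y x) = expect_unif X - expect_unif Y.
Proof. by rewrite /expect_unif sumrB mulrBl. Qed.

Lemma expect_unifZ (R : realType) (T : finType) (c : R) (X : T -> R) :
  expect_unif (fun x => c * X x) = c * expect_unif X.
Proof. by rewrite /expect_unif -mulr_sumr mulrA. Qed.

Lemma expect_unif_ge0 (R : realType) (T : finType) (X : T -> R) :
  (forall x, 0 <= X x) -> 0 <= expect_unif X.
Proof. by move=> X0; rewrite divr_ge0 // sumr_ge0. Qed.

Lemma card_perm_gt0 (T : finType) : (0 < #|{: {perm T}}|)%N.
Proof. by apply/card_gt0P; exists 1%g. Qed.

(** A form with diagonal coefficients $d$ and off-diagonal ones $e$ equals $(d-e)\sum_j w_j^2 +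
    e(\sum_j w_j)^2$. *)
Lemma expected_sqsum_affine (R : realType) (n f K M : nat) (H : {set 'I_M}) :
  (1 < n - f)%N ->
  exists alpha beta : R, forall w : 'rV[R]_(n - f), \sum_i w 0 i = 1 ->
  expect_unif (fun p : {perm 'I_n} => \sum_i mix_round K H w p 0 i ^+ 2) =
  alpha * \sum_i w 0 i ^+ 2 + beta.
Proof.
move=> m1; pose i0 := Ordinal (ltnW m1); pose i1 := Ordinal m1.
pose d := round_gram R K H i0 i0; pose e := round_gram R K H i0 i1.
exists (d - e), e => w w1; rewrite expect_unif_sqsum.
have -> : \sum_j \sum_k round_gram R K H j k * (w 0 j * w 0 k) =
          \sum_j ((d - e) * w 0 j ^+ 2 + e * (w 0 j * \sum_k w 0 k)).
  apply: eq_bigr => j _.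
  rewrite (bigD1 j) //= [\sum_k w 0 k](bigD1 j) //=.
  rewrite (round_gram_diag _ _ _ j i0) -/d.
  rewrite (eq_bigr (fun k => e * w 0 j * w 0 k)); last first.
    move=> k nkj; rewrite (@round_gram_offdiag _ _ _ _ _ _ j k i0 i1) ?mulrA //.
    by rewrite eq_sym.
  by rewrite -mulr_sumr; ring.
rewrite big_split /= -!mulr_sumr; congr (_ + _).
by rewrite -mulr_suml w1 !mulr1.
Qed.

Lemma expected_Phi_round (R : realType) (n f K M : nat) (H : {set 'I_M}) :
  (1 < n - f)%N ->
  exists lambda : R, forall w : 'rV[R]_(n - f), \sum_i w 0 i = 1 ->
  expect_unif (fun p : {perm 'I_n} => Phi (mix_round K H w p)) = lambda * Phi w.
Proof.
move=> m1; have [a [c E]] := expected_sqsum_affine R K H m1.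
have m0 : (n - f)%:R != 0 :> R by rewrite pnatr_eq0 -lt0n ltnW.
have sumu (x : R) : \sum_(i < n - f) x = (n - f)%:R * x.
  by rewrite sumr_const card_ord mulr_natl.
pose u : 'rV[R]_(n - f) := const_mx (n - f)%:R^-1.
have uE i : u 0 i = (n - f)%:R^-1 by rewrite mxE.
have mixu p : mix_round K H u p = u.
  apply/rowP => i; rewrite mix_roundE uE.
  under eq_bigr do rewrite uE.
  by rewrite -mulr_suml round_coef_row_sum mul1r.
have sqsumu : \sum_i u 0 i ^+ 2 = (n - f)%:R^-1.
  by under eq_bigr do rewrite uE; rewrite sumu expr2 mulrA divff // mul1r.
(* The affine law at the uniform vector, a fixed point of every round, determines the constant [c];
   hence [a] is the contraction factor. *)
have Eu : (n - f)%:R^-1 = a * (n - f)%:R^-1 + c.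
  rewrite -{2}sqsumu -E; last by under eq_bigr do rewrite uE; rewrite sumu divff.
  rewrite -[LHS](expect_unif_const _ (card_perm_gt0 'I_n)).
  by congr (_ / _); apply: eq_bigr => p _; rewrite mixu sqsumu.
exists a => w w1; rewrite /Phi expect_unifB expect_unif_const ?card_perm_gt0 //.
by rewrite E // mulrBr {1}Eu; ring.
Qed.

(** For total weight 1, the potential is the sum of squared deviations from $1/m$. *)
Lemma Phi_ge0 (R : realType) (m : nat) (w : 'rV[R]_m) :
  (0 < m)%N -> \sum_i w 0 i = 1 -> 0 <= Phi w.
Proof.
move=> m_gt0 w1; have m0 : m%:R != 0 :> R by rewrite pnatr_eq0 -lt0n.
suff -> : Phi w = \sum_i (w 0 i - m%:R^-1) ^+ 2.
  by apply: sumr_ge0 => i _; apply: sqr_ge0.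
under eq_bigr do rewrite sqrrB.
rewrite /Phi big_split big_split /= sumrN sumr_const card_ord.
rewrite sumrMnl -mulr_suml w1 mul1r -[X in _ = _ + X]mulr_natl.
by field.
Qed.

(** * Iteration over independent rounds *)

(** Taking [X] on sequences lets one function serve tuples of both lengths. *)
Lemma expect_unif_tupleS (R : realType) (T : finType) (t : nat)
    (X : seq T -> R) :
  expect_unif (fun rho : t.+1.-tuple T => X rho) =
  expect_unif (fun x : T => expect_unif (fun rho : t.-tuple T => X (x :: rho))).
Proof.
rewrite /expect_unif -mulr_suml -mulrA -invfM -natrM mulnC !card_tuple -expnS.
congr (_ / _); rewrite pair_bigA /=.
rewrite (reindex (fun y : T * t.-tuple T => cons_tuple y.1 y.2)) //=.
exists (fun rho => (thead rho, behead_tuple rho)) => [[x rho] _|rho _] /=.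
  by congr (_, _); apply: val_inj.
by rewrite [RHS]tuple_eta; apply: val_inj.
Qed.

Lemma foldl_mix_sum (R : realType) (n f K M : nat) (H : {set 'I_M})
    (s : seq {perm 'I_n}) (w : 'rV[R]_(n - f)) :
  \sum_i foldl (mix_round K H) w s 0 i = \sum_i w 0 i.
Proof. by elim: s w => //= p s IHs w; rewrite IHs mix_round_sum. Qed.

(** Induction on [t], conditioning on the first permutation; [w] stays general because the remaining
    rounds start from the mixed vector. *)
Lemma expect_Phi_foldl (R : realType) (n f K M : nat) (H : {set 'I_M})
    (lambda : R) :
  (forall w : 'rV[R]_(n - f), \sum_i w 0 i = 1 ->
   expect_unif (fun p : {perm 'I_n} => Phi (mix_round K H w p)) =
   lambda * Phi w) ->
  forall (t : nat) (w : 'rV[R]_(n - f)), \sum_i w 0 i = 1 ->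
  expect_unif (fun rho : t.-tuple {perm 'I_n} =>
    Phi (foldl (mix_round K H) w rho)) = lambda ^+ t * Phi w.
Proof.
move=> step; elim=> [|t IHt] w w1.
  rewrite mul1r -[RHS](@expect_unif_const _ (0.-tuple {perm 'I_n})).
    by congr (_ / _); apply: eq_bigr => rho _; rewrite tuple0.
  by rewrite card_tuple.
rewrite (expect_unif_tupleS t (fun s => Phi (foldl (mix_round K H) w s))) /=.
rewrite exprSr -mulrA -step // -expect_unifZ.
by congr (_ / _); apply: eq_bigr => p _; rewrite IHt // mix_round_sum.
Qed.

(** * Initial weights and rounding of the number of rounds *)

(** A general [F] covers both the total weight and the sum of squares. *)
Lemma init_weights_big (R : realType) (m : nat) (F : R -> R) :
  (0 < m)%N -> F 0 = 0 -> \sum_i F (init_weights R m 0 i) = F 1.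
Proof.
case: m => // m _ F0; rewrite big_ord_recl mxE /= big1 ?addr0 // => i _.
by rewrite mxE.
Qed.

(** The absolute value can only increase the ceiling, so negative [x] are covered as well. *)
Lemma le_ceiln (R : realType) (x : R) : x <= (ceiln x)%:R.
Proof.
apply: le_trans (Num.Theory.ceil_ge x) _.
by rewrite /ceiln natr_absz ler_int ler_norm.
Qed.

(** After taking logarithms, rounding [x] up is harmless since $-\ln\mu \ge 0$. *)
Lemma expr_ceiln_le (R : realType) (mu x y : R) :
  0 < mu <= 1 -> 0 < y -> ln y <= x * - ln mu -> mu ^+ ceiln x <= 1 / y.
Proof.
case/andP=> mu0 mu1 y0 hxy.
rewrite div1r -ler_ln ?posrE ?exprn_gt0 ?invr_gt0 // lnXn // lnV ?posrE //.
rewrite -mulr_natl lerNr -mulrN; apply: le_trans hxy _.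
by rewrite ler_wpM2r ?le_ceiln // oppr_ge0 ln_le0.
Qed.

Theorem theorem3 (R : realType) (n K M s f : nat)
  (hn : n = (K * M)%N) (hK : (1 <= K)%N)
  (hs : (1 <= s <= M)%N) (hf : (f + 2 <= n)%N)
  (H : {set 'I_M}) (hH : #|H| = s)
  (t0 : nat) (rho0 : t0.-tuple {perm 'I_n})
  (hPhi : 0 < Phi (weights R f K H rho0))
  (gamma : R) (hgamma : gamma = rel_decrease K H (weights R f K H rho0))
  (b : R) (hb : 1 <= b) :
  [/\ 0 < gamma < 1 ->
        expected_Phi R n f K H (ceiln (b * log (1 / (1 - gamma)) n%:R))
          <= 1 / (n%:R `^ b),
      1 / 2 <= gamma ->
        expected_Phi R n f K H (ceiln (b * log 2 n%:R)) <= 1 / (n%:R `^ b)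
    & forall c : R, 1 <= c -> 1 - n%:R `^ (- (1 / c)) <= gamma ->
        expected_Phi R n f K H (ceiln (b * c)) <= 1 / (n%:R `^ b)].
Proof.
have m1 : (1 < n - f)%N by rewrite ltn_subRL -addnS.
have m0 : (0 < n - f)%N := ltnW m1.
have n1 : 1 <= n%:R :> R.
  by rewrite ler1n (leq_trans _ hf) // addnC.
have n0 : 0 < n%:R :> R := lt_le_trans ltr01 n1.
have init1 : \sum_i init_weights R (n - f) 0 i = 1.
  exact: (@init_weights_big R _ id m0 erefl).
have w1 : \sum_i weights R f K H rho0 0 i = 1 by rewrite foldl_mix_sum.
have [lambda step] := expected_Phi_round R K H m1.
(* The weights reached after [t0] rounds have total 1 and positive potential, so the one-round law
   can be divided by that potential. *)
have gammaE : gamma = 1 - lambda.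
  rewrite hgamma /rel_decrease; set w := weights _ _ _ _ _ in hPhi w1 *.
  rewrite -[RHS](mulfK (lt0r_neq0 hPhi)) mulrBl mul1r -step //.
  rewrite -[X in (X - _) / _](@expect_unif_const _ _ _ (card_perm_gt0 'I_n)).
  rewrite -expect_unifB mulrC -expect_unifZ.
  by congr (_ / _); apply: eq_bigr => p _; rewrite mulrC.
have lambda0 : 0 <= lambda.
  rewrite -(pmulr_lge0 _ hPhi) -step //; apply: expect_unif_ge0 => p.
  by apply: Phi_ge0; rewrite // mix_round_sum.
(* The initial potential is $1 - 1/(n-f) \le 1$. *)
have EPhi t : expected_Phi R n f K H t <= lambda ^+ t.
  rewrite /expected_Phi /weights (expect_Phi_foldl step) //.
  apply: ler_piMr; first exact: exprn_ge0.
  rewrite /Phi (@init_weights_big _ _ (fun x => x ^+ 2)) ?expr0n ?expr1n //.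
  by rewrite gerBl invr_ge0 ler0n.
(* Common to the three cases. A positive bound [mu] stands in for [lambda], which may be 0 in the
   last two. *)
have key mu x : lambda <= mu -> 0 < mu <= 1 -> b * ln n%:R <= x * - ln mu ->
    expected_Phi R n f K H (ceiln x) <= 1 / (n%:R `^ b).
  move=> lemu mu01 hx; apply: le_trans (EPhi _) _.
  apply: le_trans (_ : mu ^+ ceiln x <= _).
    by apply: lerXn2r; rewrite ?nnegrE //; apply: le_trans lemu.
  by apply: expr_ceiln_le; rewrite ?powR_gt0 // ln_powR.
split.
- rewrite gammaE => /andP[g0 g1].
  have l0 : 0 < lambda by lra.
  have l1 : lambda < 1 by lra.
  have lnl : ln lambda < 0 by rewrite ln_lt0 // l0.
  (* Here [mu] is [lambda] itself, and its nonzero logarithm cancels the one in the base. *)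
  apply: (key lambda); [by [] | by rewrite l0 ltW |].
  have -> : 1 / (1 - (1 - lambda)) = lambda^-1 by rewrite div1r; congr _^-1; ring.
  by rewrite /log lnV // -mulrA divfK // oppr_eq0 lt_eqF.
- rewrite gammaE => g.
  have ln2 : 0 < ln (2 : R) by rewrite ln_gt0 // ltr1n.
  (* With $\mu = 1/2$, $-\ln\mu = \ln 2$ cancels the denominator of $\log_2 n$. *)
  apply: (key 2^-1); [lra | by apply/andP; split; lra |].
  by rewrite /log lnV ?posrE // opprK -mulrA divfK // gt_eqF.
- move=> c c1; rewrite gammaE => g.
  have c0 : 0 < c := lt_le_trans ltr01 c1.
  (* With $\mu = n^{-1/c}$, $-\ln\mu = (\ln n)/c$, and multiplying by $bc$ gives exactly $b\ln
     n$. *)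
  apply: (key (n%:R `^ (- (1 / c)))); first by lra.
    rewrite powR_gt0 //= powRN invf_le1 ?powR_gt0 //.
    by rewrite -[leLHS](powRr0 n%:R) ler_powR // divr_ge0 // ltW.
  by rewrite ln_powR mulNr opprK -mulrA mulrA div1r mulrA mulfK // gt_eqF.
Qed.
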